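(* $$8\sqrt2=\sum_{j=0}^{\infty}\left(-\frac14\right)^{j}\frac{\left(\frac58\right)_j\left(\frac34\right)_j\left(\frac98\right)_j}{\left(\frac12\right)_j(1)_j\left(\frac32\right)_j}\,(40j+19).$$
   Context: $(x)_0=1$ and $(x)_j=x(x+1)\cdots(x+j-1)$ for positive integers $j$ (rising factorial). *)

(* Defs.v *)
From Stdlib Require Import Reals.
Open Scope R_scope.

Fixpoint rising_factorial (x : R) (j : nat) : R :=
  match j with
  | O => 1
  | S k => rising_factorial x k * (x + INR k)
  end.

(* Main.v *)
Require Import Defs.
From Stdlib Require Import Reals Lra Lia.
From Coquelicot Require Import Coquelicot.
Open Scope R_scope.

(** The series is the member m = 0 of a family of series with constant sum, and the
    sum is read off as m tends to infinity.

    For general m the denominator parameters 3/8, 7/8, 1/2, 1/4 of [weight] are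
    shifted by m.  At m = 0 three of them cancel, up to linear factors, against
    the numerator parameters 3/8, -1/8, 1/4; these linear factors divide the cubic
    [term_poly 0], and [term 0] becomes the given summand divided by -64
    ([summand_eq]).  The family is the accelerated form of a times the
    well-poised sum 5F4(a, 1 + a/2, b, c, d; 1) with b, c, d = 3/8, -1/8, 1/4 and
    a = m - 1/4, whose value by Dougall is a quotient of Gamma functions of m;
    [scale] is that quotient relative to m = 0, so that dividing by it makes the
    sum independent of m.

    Independence is proved by a Wilf-Zeilberger pair: [term (S m) n - term m n] is
    the difference in n of the certificate [cert] ([wz_identity]), which vanishes at
    n = 0 and tends to 0 as n grows, so consecutive series have the same sum
    ([Series_term_succ]).

    As m tends to infinity, the terms with n > 0 contribute O(1/m), because they
    are dominated by a geometric series of ratio 3/4 ([term_tail_lim]).  Since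
    [term m 0] equals -1/4 divided by [root2_approx m], up to a rational factor
    tending to 1, it remains to compute one limit.  With
    r(m) = (3/4)_m / (1/4)_m, duplication gives [root2_approx m] = r(2m) / r(m); as
    r(m) grows like the square root of m, this tends to sqrt 2.  Hence the sum for
    m = 0 is -1 / (4 sqrt 2), and the series equals 16 / sqrt 2 = 8 sqrt 2. *)

(** * Rising factorials *)

Notation poch := rising_factorial.

Lemma poch_shift (x : R) (n : nat) : poch x (S n) = x * poch (x + 1) n.
Proof.
induction n as [|n IH]; [simpl; ring|].
change (poch x (S n) * (x + INR (S n)) = x * (poch (x + 1) n * (x + 1 + INR n))).
rewrite IH, S_INR; ring.
Qed.

Lemma poch_shift_comm (x : R) (n : nat) :
  x * poch (x + 1) n = poch x n * (x + INR n).
Proof. rewrite <- poch_shift; reflexivity. Qed.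

Lemma poch_pos (x : R) (n : nat) : 0 < x -> 0 < poch x n.
Proof.
intros Hx; induction n as [|n IH]; simpl; [lra|].
pose proof (pos_INR n); apply Rmult_lt_0_compat; lra.
Qed.

Lemma poch_double (x : R) (n : nat) :
  poch x (2 * n) = 4 ^ n * (poch (x / 2) n * poch ((x + 1) / 2) n).
Proof.
induction n as [|n IH]; [simpl; ring|].
replace (2 * S n)%nat with (S (S (2 * n))) by lia.
cbn [rising_factorial pow].
rewrite IH, S_INR, mult_INR; simpl (INR 2); field.
Qed.

(** * The shifted family and its Wilf-Zeilberger certificate *)

(** The product of (1)_n and (3/2)_n is (2n+1)! / 4^n.  The last factor has n + 1
    terms, which absorbs the linear denominator 1/4 + x + n of the accelerated
    summand. *)
Definition weight (x : R) (n : nat) : R :=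
  (- (1 / 4)) ^ n
  * (poch (3 / 8) n * poch (5 / 8) n * poch (- (1 / 8)) n * poch (9 / 8) n
     * poch (1 / 4) n * poch (3 / 4) n)
  / (poch 1 n * poch (3 / 2) n
     * (poch (3 / 8 + x) n * poch (7 / 8 + x) n * poch (1 / 2 + x) n
        * poch (1 / 4 + x) (S n))).

(** [numer] and [denom] are the parts of the quotient of consecutive weights that
    come from the numerator and from the shifted denominator parameters. *)
Definition numer (t : R) : R :=
  (t + 3 / 8) * (t + 5 / 8) * (t - 1 / 8) * (t + 9 / 8) * (t + 1 / 4) * (t + 3 / 4).

Definition denom (s : R) : R :=
  (s + 3 / 8) * (s + 7 / 8) * (s + 1 / 2) * (s + 5 / 4).

Lemma denom_pos (s : R) : 0 <= s -> 0 < denom s.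
Proof.
intros Hs; unfold denom; repeat apply Rmult_lt_0_compat; lra.
Qed.

Lemma weight_succ (x : R) (n : nat) : 0 <= x ->
  weight x (S n)
  = weight x n
    * (- (1 / 4) * (numer (INR n) / ((INR n + 1) * (INR n + 3 / 2) * denom (x + INR n)))).
Proof.
intros Hx; pose proof (pos_INR n) as Hn.
unfold weight, numer, denom.
pose proof (poch_pos 1 n ltac:(lra)) as H1.
pose proof (poch_pos (3 / 2) n ltac:(lra)) as H2.
pose proof (poch_pos (3 / 8 + x) n ltac:(lra)) as H3.
pose proof (poch_pos (7 / 8 + x) n ltac:(lra)) as H4.
pose proof (poch_pos (1 / 2 + x) n ltac:(lra)) as H5.
pose proof (poch_pos (1 / 4 + x) n ltac:(lra)) as H6.
cbn [rising_factorial pow]; rewrite ?S_INR.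
field; repeat split; lra.
Qed.

(** Every shifted Pochhammer symbol changes by a quotient of two linear factors
    when x increases by 1; the numerators of these quotients multiply to [denom]. *)
Lemma weight_shift (x : R) (n : nat) : 0 <= x ->
  weight (x + 1) n * denom (x + INR n)
  = weight x n * ((x + 3 / 8) * (x + 7 / 8) * (x + 1 / 2) * (x + 1 / 4)).
Proof.
intros Hx; pose proof (pos_INR n) as Hn.
unfold weight, denom.
pose proof (poch_pos 1 n ltac:(lra)) as H1.
pose proof (poch_pos (3 / 2) n ltac:(lra)) as H2.
pose proof (poch_pos (3 / 8 + x) n ltac:(lra)) as H3.
pose proof (poch_pos (7 / 8 + x) n ltac:(lra)) as H4.
pose proof (poch_pos (1 / 2 + x) n ltac:(lra)) as H5.
pose proof (poch_pos (1 / 4 + x) (S n) ltac:(lra)) as H6.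
assert (shift : forall a k, 0 < a ->
          poch (a + (x + 1)) k = poch (a + x) k * (a + x + INR k) / (a + x)).
{ intros a k Ha; rewrite <- poch_shift_comm, Rplus_assoc; field; lra. }
rewrite !shift by lra.
rewrite S_INR.
field; repeat split; lra.
Qed.

Definition term_poly (x n : R) : R :=
  5 * n ^ 3 + (6 * x + 3) * n ^ 2 + (2 * x ^ 2 + 3 * x + 9 / 64) * n
  + (x ^ 2 - 19 / 256).

(** The factor n makes the certificate vanish at n = 0, so that the telescoping sum
    leaves no boundary term there. *)
Definition cert_poly (x n : R) : R := 2 * n * (2 * n + 1) * (n + 2 * x).

(** This is the Gamma quotient
    a G(a+1-b) G(a+1-c) G(a+1-d) G(a+1-b-c-d)
    / (G(a+1) G(a+1-b-c) G(a+1-b-d) G(a+1-c-d))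
    at a = m - 1/4, b = 3/8, c = -1/8, d = 1/4, divided by its value at m = 0; the
    factors G(m + 1/2) cancel, and a / G(a+1) = 1 / G(a) gives the parameter -1/4. *)
Definition scale (m : nat) : R :=
  (poch (3 / 8) m * poch (7 / 8) m * poch (1 / 4) m)
  / (poch (- (1 / 4)) m * poch (1 / 8) m * poch (5 / 8) m).

Definition term (m n : nat) : R :=
  weight (INR m) n * term_poly (INR m) (INR n) / scale m.

Definition cert (m n : nat) : R :=
  weight (INR m) n * cert_poly (INR m) (INR n) / scale m.

(** The parameter -1/4 of [scale] is the only negative one, and no natural number
    m makes its factor m - 1/4 vanish. *)
Lemma INR_neq_quarter (m : nat) : INR m <> 1 / 4.
Proof.
destruct m as [|m]; [simpl; lra|rewrite S_INR; pose proof (pos_INR m); lra].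
Qed.

Lemma poch_neg_quarter_neq0 (m : nat) : poch (- (1 / 4)) m <> 0.
Proof.
induction m as [|m IH]; simpl; [lra|].
apply Rmult_integral_contrapositive; split; [exact IH|].
pose proof (INR_neq_quarter m); lra.
Qed.

Lemma scale_neq0 (m : nat) : scale m <> 0.
Proof.
unfold scale, Rdiv.
pose proof (poch_pos (3 / 8) m ltac:(lra)); pose proof (poch_pos (7 / 8) m ltac:(lra)).
pose proof (poch_pos (1 / 4) m ltac:(lra)); pose proof (poch_pos (1 / 8) m ltac:(lra)).
pose proof (poch_pos (5 / 8) m ltac:(lra)); pose proof (poch_neg_quarter_neq0 m).
repeat (apply Rmult_integral_contrapositive_currified || apply Rinv_neq_0_compat); lra.
Qed.

Lemma scale_succ (m : nat) :
  scale (S m)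
  = scale m * ((INR m + 3 / 8) * (INR m + 7 / 8) * (INR m + 1 / 4)
               / ((INR m - 1 / 4) * (INR m + 1 / 8) * (INR m + 5 / 8))).
Proof.
unfold scale; cbn [rising_factorial].
pose proof (poch_pos (1 / 8) m ltac:(lra)); pose proof (poch_pos (5 / 8) m ltac:(lra)).
pose proof (poch_neg_quarter_neq0 m); pose proof (INR_neq_quarter m).
pose proof (pos_INR m).
field; repeat split; lra.
Qed.

(** After division by the common weight, both sides are rational functions of m
    and n, and the identity is a polynomial one. *)
Lemma wz_identity (m n : nat) :
  term (S m) n - term m n = cert m (S n) - cert m n.
Proof.
pose proof (pos_INR m) as Hm; pose proof (pos_INR n) as Hn.
pose proof (scale_neq0 m) as Hs; pose proof (INR_neq_quarter m) as Hq.
pose proof (denom_pos (INR m + INR n) ltac:(lra)) as Hd.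
unfold term, cert; rewrite scale_succ, weight_succ, !S_INR by exact Hm.
pose proof (weight_shift (INR m) n Hm) as Hw.
assert (Hw' : weight (INR m + 1) n
  = weight (INR m) n * ((INR m + 3 / 8) * (INR m + 7 / 8) * (INR m + 1 / 2) * (INR m + 1 / 4))
    / denom (INR m + INR n)).
{ rewrite <- Hw; field; lra. }
rewrite Hw'; clear Hw Hw'.
revert Hd; unfold numer, denom, term_poly, cert_poly.
generalize (weight (INR m) n) (scale m) (INR m) (INR n) Hm Hn Hs Hq.
clear; intros w s x t Hx Ht Hs Hq Hd.
field; repeat split; lra.
Qed.

(** * Geometric bounds *)

(** Each linear factor of [numer] is dominated by a factor of the denominator,
    matched in the order displayed in the proof. *)
Lemma Rabs_weight_succ (x : R) (n : nat) : 0 <= x ->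
  Rabs (weight x (S n)) <= Rabs (weight x n) * (1 / 4).
Proof.
intros Hx; rewrite weight_succ by exact Hx.
rewrite Rabs_mult; apply Rmult_le_compat_l; [apply Rabs_pos|].
rewrite Rabs_mult, Rabs_Ropp, (Rabs_pos_eq (1 / 4)) by lra.
rewrite <- (Rmult_1_r (1 / 4)) at 2; apply Rmult_le_compat_l; [lra|].
pose proof (pos_INR n) as Hn; set (t := INR n) in *.
pose proof (denom_pos (x + t) ltac:(lra)) as Hd.
assert (Hpos : 0 < (t + 1) * (t + 3 / 2) * denom (x + t))
  by (repeat apply Rmult_lt_0_compat; lra).
rewrite Rabs_div, (Rabs_pos_eq (_ * denom _)) by lra.
apply (Rdiv_le_1 _ _ Hpos).
unfold numer, denom; rewrite !Rabs_mult.
replace ((t + 1) * (t + 3 / 2) * _)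
  with ((x + t + 3 / 8) * (x + t + 7 / 8) * (t + 3 / 2) * (x + t + 5 / 4)
        * (x + t + 1 / 2) * (t + 1)) by ring.
repeat (apply Rmult_le_compat; try (repeat apply Rmult_le_pos; apply Rabs_pos));
  try apply Rabs_pos; apply Rabs_le; lra.
Qed.

Lemma Rabs_weight_add (x : R) (k n : nat) : 0 <= x ->
  Rabs (weight x (k + n)) <= Rabs (weight x k) * (1 / 4) ^ n.
Proof.
intros Hx; induction n as [|n IH].
- rewrite Nat.add_0_r; simpl; lra.
- rewrite Nat.add_succ_r; pose proof (Rabs_weight_succ x (k + n) Hx); simpl; lra.
Qed.

Lemma weight_0 (x : R) : weight x 0 = / (1 / 4 + x).
Proof. 
unfold weight; simpl; unfold Rdiv; rewrite !Rmult_1_l, Rplus_0_r; reflexivity.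
Qed.

Lemma Rabs_weight_0 (x : R) : 0 <= x -> Rabs (weight x 0) <= 4.
Proof.
intros Hx; rewrite weight_0, Rabs_pos_eq.
- replace 4 with (/ (1 / 4)) by field; apply Rinv_le_contravar; lra.
- apply Rlt_le, Rinv_0_lt_compat; lra.
Qed.

(** The gain of two powers of x over [Rabs_weight_0] compensates the quadratic
    growth in x of [term_poly]. *)
Lemma Rabs_weight_1 (x : R) : 0 <= x -> Rabs (weight x 1) <= / (x + 1) ^ 2.
Proof.
intros Hx; rewrite weight_succ, weight_0 by exact Hx; simpl (INR 0); rewrite Rplus_0_r.
pose proof (denom_pos x Hx) as Hd.
(* [numer 0] / 6 is - 405 / 393216. *)
replace (_ * _) with (405 / 393216 * / ((1 / 4 + x) * denom x))
  by (unfold numer; field; lra).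
assert (H : (x + 1) ^ 2 <= 393216 / 405 * ((1 / 4 + x) * denom x)).
{ unfold denom; nra. }
rewrite Rabs_pos_eq.
- replace (405 / 393216 * _) with (/ (393216 / 405 * ((1 / 4 + x) * denom x)))
    by (field; lra).
  apply Rinv_le_contravar; [apply pow_lt; lra | exact H].
- apply Rmult_le_pos; [lra|]; apply Rlt_le, Rinv_0_lt_compat, Rmult_lt_0_compat; lra.
Qed.

(** The constant 3 of the recurrence (n + 4)^3 <= 3 (n + 3)^3 leaves a ratio 3/4
    once the factor 1/4 of the weights is taken into account. *)
Lemma cube_le_pow3 (n : nat) : (INR n + 3) ^ 3 <= 27 * 3 ^ n.
Proof.
induction n as [|n IH]; [simpl; lra|].
rewrite S_INR; pose proof (pos_INR n).
change (3 ^ S n) with (3 * 3 ^ n); nra.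
Qed.

(** The left-hand side dominates, coefficient by coefficient, both the polynomial
    factor of the terms and that of the certificate. *)
Lemma cubic_growth (x : R) (n : nat) : 0 <= x ->
  5 * INR n ^ 3 + (8 * x + 3) * INR n ^ 2 + (2 * x ^ 2 + 4 * x + 1) * INR n
  + (x ^ 2 + 1)
  <= 135 * (x + 1) ^ 2 * 3 ^ n.
Proof.
intros Hx; pose proof (pos_INR n) as Hn; pose proof (cube_le_pow3 n) as H3.
apply Rle_trans with (5 * (x + 1) ^ 2 * (INR n + 3) ^ 3).
- clear H3; set (t := INR n) in *.
  assert (0 <= x * t) by nra; assert (0 <= x * x) by nra; assert (0 <= t * t) by nra.
  assert (0 <= x * x * t) by nra; assert (0 <= x * (t * t)) by nra.
  assert (0 <= (x * x) * (t * t)) by nra.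
  assert (0 <= t * (t * t)) by nra; assert (0 <= x * t * (t * t)) by nra.
  assert (0 <= (x * x * t) * (t * t)) by nra.
  ring_simplify; lra.
- replace (135 * (x + 1) ^ 2 * 3 ^ n) with (5 * (x + 1) ^ 2 * (27 * 3 ^ n)) by ring.
  apply Rmult_le_compat_l; [|exact H3]; pose proof (pow2_ge_0 (x + 1)); lra.
Qed.

Lemma Rabs_term_poly (x : R) (n : nat) : 0 <= x ->
  Rabs (term_poly x (INR n)) <= 135 * (x + 1) ^ 2 * 3 ^ n.
Proof.
intros Hx; apply Rle_trans with (2 := cubic_growth x n Hx).
pose proof (pos_INR n); unfold term_poly; apply Rabs_le; set (t := INR n) in *.
assert (0 <= x * t) by nra; assert (0 <= x ^ 2) by nra; assert (0 <= t ^ 2) by nra.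
assert (0 <= x * t ^ 2) by nra; assert (0 <= x ^ 2 * t) by nra.
assert (0 <= t ^ 3) by (apply pow_le; lra).
split; lra.
Qed.

Lemma Rabs_cert_poly (x : R) (n : nat) : 0 <= x ->
  Rabs (cert_poly x (INR n)) <= 135 * (x + 1) ^ 2 * 3 ^ n.
Proof.
intros Hx; apply Rle_trans with (2 := cubic_growth x n Hx).
pose proof (pos_INR n); unfold cert_poly; apply Rabs_le; set (t := INR n) in *.
assert (0 <= x * t) by nra; assert (0 <= x ^ 2) by nra; assert (0 <= t ^ 2) by nra.
assert (0 <= x * t ^ 2) by nra; assert (0 <= x ^ 2 * t) by nra.
assert (0 <= t ^ 3) by (apply pow_le; lra).
split; ring_simplify; lra.
Qed.

(** * The limit of the normalising factor *)

(** This quotient grows like the square root of m.  Its square divided by m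
    decreases, and its square divided by m + 1/4 increases; comparing the indices m
    and 2m in both statements encloses the square of [root2_approx m], so that no
    asymptotic formula is needed. *)
Definition ratio (m : nat) : R := poch (3 / 4) m / poch (1 / 4) m.

Lemma ratio_pos (m : nat) : 0 < ratio m.
Proof. apply Rdiv_lt_0_compat; apply poch_pos; lra. Qed.

Lemma ratio_succ (m : nat) : ratio (S m) = ratio m * ((INR m + 3 / 4) / (INR m + 1 / 4)).
Proof.
unfold ratio; cbn [rising_factorial]; pose proof (pos_INR m).
pose proof (poch_pos (1 / 4) m ltac:(lra)); field; lra.
Qed.

Lemma ratio_sqr_upper (m k : nat) :
  (ratio (S m + k)) ^ 2 * INR (S m) <= (ratio (S m)) ^ 2 * INR (S m + k).
Proof.
induction k as [|k IH]; [rewrite Nat.add_0_r; lra|].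
rewrite Nat.add_succ_r, ratio_succ, (S_INR (S m + k)).
assert (Ht : 0 < INR (S m + k)) by (apply lt_0_INR; lia).
set (t := INR (S m + k)) in *; set (r := ratio (S m + k)) in *.
assert (H : ((t + 3 / 4) / (t + 1 / 4)) ^ 2 <= (t + 1) / t).
{ apply Rminus_le.
  replace (_ - _) with (- (1 / 16) / (t * (t + 1 / 4) ^ 2)) by (field; lra).
  unfold Rdiv; rewrite !Ropp_mult_distr_l_reverse; apply Rge_le, Ropp_0_le_ge_contravar.
  apply Rlt_le, Rdiv_lt_0_compat; [lra|]; apply Rmult_lt_0_compat; [lra|apply pow_lt; lra]. }
replace ((r * _) ^ 2 * INR (S m))
  with (((t + 3 / 4) / (t + 1 / 4)) ^ 2 * (r ^ 2 * INR (S m))) by ring.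
replace (ratio (S m) ^ 2 * (t + 1))
  with ((t + 1) / t * (ratio (S m) ^ 2 * t)) by (field; lra).
apply Rmult_le_compat; [apply pow2_ge_0| |exact H|exact IH].
apply Rmult_le_pos; [apply pow2_ge_0|apply pos_INR].
Qed.

Lemma ratio_sqr_lower (m k : nat) :
  (ratio m) ^ 2 * (INR (m + k) + 1 / 4) <= (ratio (m + k)) ^ 2 * (INR m + 1 / 4).
Proof.
induction k as [|k IH]; [rewrite Nat.add_0_r; lra|].
rewrite Nat.add_succ_r, ratio_succ, S_INR.
pose proof (pos_INR (m + k)) as Ht; pose proof (pos_INR m).
set (t := INR (m + k)) in *; set (r := ratio (m + k)) in *.
assert (H0 : (t + 5 / 4) / (t + 1 / 4) <= ((t + 3 / 4) / (t + 1 / 4)) ^ 2).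
{ apply Rminus_le.
  replace (_ - _) with (- ((1 / 4) / (t + 1 / 4) ^ 2)) by (field; lra).
  apply Rge_le, Ropp_0_le_ge_contravar, Rlt_le, Rdiv_lt_0_compat; [lra|apply pow_lt; lra]. }
replace ((r * _) ^ 2 * (INR m + 1 / 4))
  with (((t + 3 / 4) / (t + 1 / 4)) ^ 2 * (r ^ 2 * (INR m + 1 / 4))) by ring.
replace (ratio m ^ 2 * (t + 1 + 1 / 4))
  with ((t + 5 / 4) / (t + 1 / 4) * (ratio m ^ 2 * (t + 1 / 4))) by (field; lra).
apply Rmult_le_compat; [| |exact H0|exact IH].
- apply Rlt_le, Rdiv_lt_0_compat; lra.
- apply Rmult_le_pos; [apply pow2_ge_0|lra].
Qed.

(** By duplication this is (3/8)_m (7/8)_m (1/4)_m / ((1/8)_m (5/8)_m (3/4)_m),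
    the nonlinear part of [scale]. *)
Definition root2_approx (m : nat) : R := ratio (2 * m) / ratio m.

(** The linear factor turns the parameter -1/4 into 3/4. *)
Lemma scale_eq (m : nat) : scale m = (1 - 4 * INR m) * root2_approx m.
Proof.
unfold scale, root2_approx, ratio; rewrite !poch_double.
replace (3 / 4 / 2) with (3 / 8) by field; replace ((3 / 4 + 1) / 2) with (7 / 8) by field.
replace (1 / 4 / 2) with (1 / 8) by field; replace ((1 / 4 + 1) / 2) with (5 / 8) by field.
pose proof (poch_shift_comm (- (1 / 4)) m) as H.
replace (- (1 / 4) + 1) with (3 / 4) in H by field.
replace (poch (3 / 4) m) with (poch (- (1 / 4)) m * (1 - 4 * INR m)) by lra.
pose proof (poch_pos (1 / 8) m ltac:(lra)); pose proof (poch_pos (5 / 8) m ltac:(lra)).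
pose proof (poch_pos (1 / 4) m ltac:(lra)); pose proof (poch_neg_quarter_neq0 m).
pose proof (INR_neq_quarter m); pose proof (pow_lt 4 m ltac:(lra)).
field; repeat split; lra.
Qed.

(** Both bounds follow from (2m + 1/4) / (m + 1/4) <= q^2 <= 2, where m >= 1 and
    q = [root2_approx m]. *)
Lemma root2_approx_bounds (m : nat) :
  1 <= root2_approx (S m) /\ Rabs (root2_approx (S m) - sqrt 2) <= / (INR m + 1).
Proof.
pose proof (ratio_pos (S m)) as Hr; pose proof (ratio_pos (2 * S m)) as Hr2.
pose proof (ratio_sqr_upper m (S m)) as Hu; pose proof (ratio_sqr_lower (S m) (S m)) as Hl.
replace (S m + S m)%nat with (2 * S m)%nat in Hu, Hl by lia.
rewrite mult_INR in Hu, Hl; simpl (INR 2) in Hu, Hl.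
rewrite S_INR in Hu, Hl; pose proof (pos_INR m) as Hm.
set (x := INR m + 1) in *.
assert (Hx : 1 <= x) by (unfold x; lra).
set (q := root2_approx (S m)).
assert (Hq : ratio (2 * S m) = q * ratio (S m))
  by (unfold q, root2_approx; field; lra).
assert (Hq0 : 0 < q) by (apply Rdiv_lt_0_compat; assumption).
assert (Hrr : 0 < ratio (S m) ^ 2) by (apply pow_lt; exact Hr).
rewrite Hq in Hu, Hl; clear Hq.
set (s := ratio (S m) ^ 2) in *.
replace ((q * ratio (S m)) ^ 2) with (s * q ^ 2) in Hu, Hl by (unfold s; ring).
assert (Hu' : q ^ 2 <= 2).
{ apply (Rmult_le_reg_l (s * x)); nra. }
assert (Hl' : 2 * x + 1 / 4 <= q ^ 2 * (x + 1 / 4)).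
{ apply (Rmult_le_reg_l s); nra. }
assert (H1 : 1 <= q) by nra.
split; [exact H1|].
pose proof (sqrt_pos 2) as Hs; pose proof (pow2_sqrt 2 ltac:(lra)) as Hs2.
assert (Hle : q <= sqrt 2) by nra.
rewrite Rabs_left1 by lra.
apply (Rmult_le_reg_l x); [lra|]; rewrite Rinv_r by lra.
nra.
Qed.

Lemma Rabs_scale_lower (m : nat) : INR (S m) <= Rabs (scale (S m)).
Proof.
rewrite scale_eq, Rabs_mult.
destruct (root2_approx_bounds m) as [H _].
rewrite (Rabs_pos_eq (root2_approx _)) by lra.
rewrite S_INR; pose proof (pos_INR m); rewrite Rabs_left1 by lra; nra.
Qed.

(** * Sum of the family *)

Lemma pow_three_quarters (n : nat) : (3 / 4) ^ n = (1 / 4) ^ n * 3 ^ n.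
Proof. rewrite <- Rpow_mult_distr; f_equal; field. Qed.

Lemma Rabs_weight_poly (m n : nat) (P : R) :
  Rabs P <= 135 * (INR m + 1) ^ 2 * 3 ^ n ->
  Rabs (weight (INR m) n * P / scale m)
  <= 540 * (INR m + 1) ^ 2 / Rabs (scale m) * (3 / 4) ^ n.
Proof.
intros HP; pose proof (pos_INR m) as Hm.
pose proof (Rabs_pos_lt _ (scale_neq0 m)) as Hs.
rewrite Rabs_div, Rabs_mult by apply scale_neq0.
pose proof (Rabs_weight_add (INR m) 0 n Hm) as Hw; rewrite Nat.add_0_l in Hw.
pose proof (Rabs_weight_0 (INR m) Hm) as Hw0.
replace (_ * (3 / 4) ^ n)
  with (4 * (1 / 4) ^ n * (135 * (INR m + 1) ^ 2 * 3 ^ n) / Rabs (scale m))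
  by (rewrite pow_three_quarters; field; lra).
apply Rmult_le_compat_r; [apply Rlt_le, Rinv_0_lt_compat, Hs|].
apply Rmult_le_compat; try apply Rabs_pos; [|exact HP].
apply Rle_trans with (1 := Hw); apply Rmult_le_compat_r; [|exact Hw0].
apply pow_le; lra.
Qed.

Lemma Rabs_term_succ (m n : nat) :
  Rabs (term m (S n)) <= 405 / Rabs (scale m) * (3 / 4) ^ n.
Proof.
pose proof (pos_INR m) as Hm; pose proof (Rabs_pos_lt _ (scale_neq0 m)) as Hs.
unfold term; rewrite Rabs_div, Rabs_mult by apply scale_neq0.
pose proof (Rabs_weight_add (INR m) 1 n Hm) as Hw; change (1 + n)%nat with (S n) in Hw.
pose proof (Rabs_weight_1 (INR m) Hm) as Hw1.
assert (Hsq : 0 < (INR m + 1) ^ 2) by (apply pow_lt; lra).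
replace (_ * (3 / 4) ^ n)
  with (/ (INR m + 1) ^ 2 * (1 / 4) ^ n * (135 * (INR m + 1) ^ 2 * 3 ^ S n)
        / Rabs (scale m))
  by (rewrite pow_three_quarters; simpl; field; lra).
apply Rmult_le_compat_r; [apply Rlt_le, Rinv_0_lt_compat, Hs|].
apply Rmult_le_compat; try apply Rabs_pos; [|apply Rabs_term_poly; exact Hm].
apply Rle_trans with (1 := Hw); apply Rmult_le_compat_r; [|exact Hw1].
apply pow_le; lra.
Qed.

(** The bound is stated at S m because the estimates of [root2_approx] and [scale]
    start at m = 1. *)
Lemma is_lim_seq_harmonic_bound (u : nat -> R) (l C : R) :
  (forall m, Rabs (u (S m) - l) <= C / (INR m + 1)) -> is_lim_seq u l.
Proof.
intros H; apply is_lim_seq_incr_1.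
assert (Hc : is_lim_seq (fun m => C / (INR m + 1)) 0).
{ replace (Finite 0) with (Rbar_mult C 0) by (simpl; f_equal; ring).
  apply is_lim_seq_scal_l.
  apply is_lim_seq_ext with (fun m => / INR (S m)); [intros m; now rewrite S_INR|].
  apply (is_lim_seq_incr_1 (fun m => / INR m)).
  replace (Finite 0) with (Rbar_inv p_infty) by reflexivity.
  apply is_lim_seq_inv; [apply is_lim_seq_INR|discriminate]. }
apply is_lim_seq_ext with (fun m => (u (S m) - l) + l); [intros m; ring|].
replace (Finite l) with (Rbar_plus 0 l) by (simpl; f_equal; ring).
apply is_lim_seq_plus'; [|apply is_lim_seq_const].
apply is_lim_seq_abs_0.
apply is_lim_seq_le_le with (fun _ => 0) (fun m => C / (INR m + 1));
  [|apply is_lim_seq_const|exact Hc].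
intros m; split; [apply Rabs_pos|apply H].
Qed.

Lemma is_series_three_quarters (C : R) : is_series (fun n => C * (3 / 4) ^ n) (C * 4).
Proof.
apply (is_series_scal_l (K := R_AbsRing) C (fun n => (3 / 4) ^ n) 4).
pose proof (is_series_geom (3 / 4)) as H.
replace (/ (1 - 3 / 4)) with 4 in H by field.
apply H; rewrite Rabs_pos_eq; lra.
Qed.

Lemma ex_series_term (m : nat) : ex_series (term m).
Proof.
apply (ex_series_le (K := R_AbsRing) (V := R_CompleteNormedModule) (term m)
         (fun n => 540 * (INR m + 1) ^ 2 / Rabs (scale m) * (3 / 4) ^ n)).
- intros n; apply Rabs_weight_poly, Rabs_term_poly, pos_INR.
- eexists; apply is_series_three_quarters.
Qed.

Lemma cert_lim (m : nat) : is_lim_seq (cert m) 0.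
Proof.
apply is_lim_seq_abs_0.
apply is_lim_seq_le_le with (fun _ => 0)
  (fun n => 540 * (INR m + 1) ^ 2 / Rabs (scale m) * (3 / 4) ^ n);
  [|apply is_lim_seq_const|].
- intros n; split; [apply Rabs_pos|].
  apply Rabs_weight_poly, Rabs_cert_poly, pos_INR.
- replace (Finite 0) with (Rbar_mult (540 * (INR m + 1) ^ 2 / Rabs (scale m)) 0)
    by (simpl; f_equal; ring).
  apply is_lim_seq_scal_l, is_lim_seq_geom; rewrite Rabs_pos_eq; lra.
Qed.

(** The partial sums of the difference are the values of the certificate. *)
Lemma Series_term_succ (m : nat) : Series (term (S m)) = Series (term m).
Proof.
apply Rminus_diag_uniq.
rewrite <- Series_minus by apply ex_series_term.
apply is_series_unique.
apply (is_lim_seq_ext (fun n => cert m (S n))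
  (sum_n (fun n => term (S m) n - term m n)) 0); 
  [|apply (proj1 (is_lim_seq_incr_1 (cert m) 0)), cert_lim].
intros n; induction n as [|n IH].
- rewrite sum_O, wz_identity; unfold cert at 3, cert_poly; simpl (INR 0); unfold Rdiv; ring.
- rewrite sum_Sn, <- IH, wz_identity; unfold plus; simpl; ring.
Qed.

Lemma Series_term_const (m : nat) : Series (term m) = Series (term 0).
Proof. induction m as [|m IH]; [reflexivity|now rewrite Series_term_succ]. Qed.

Lemma term_tail_lim : is_lim_seq (fun m => Series (fun n => term m (S n))) 0.
Proof.
apply (is_lim_seq_harmonic_bound _ 0 1620); intros m.
rewrite Rminus_0_r.
pose proof (Rabs_scale_lower m) as Hs; rewrite S_INR in Hs.
pose proof (pos_INR m) as Hm.
set (K := 405 / Rabs (scale (S m))).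
pose proof (is_series_three_quarters K) as HK.
assert (Habs : ex_series (fun n => Rabs (term (S m) (S n)))).
{ apply (ex_series_le (K := R_AbsRing) (V := R_CompleteNormedModule) _
           (fun n => K * (3 / 4) ^ n)); [|eexists; exact HK].
  intros n; unfold norm; simpl; unfold abs; simpl; rewrite Rabs_Rabsolu.
  apply Rabs_term_succ. }
apply Rle_trans with (1 := Series_Rabs _ Habs).
apply Rle_trans with (K * 4).
- rewrite <- (is_series_unique _ _ HK); apply Series_le; [|eexists; exact HK].
  intros n; split; [apply Rabs_pos|apply Rabs_term_succ].
- unfold K; replace (405 / _ * 4) with (1620 * / Rabs (scale (S m))) by (field; lra).
  apply Rmult_le_compat_l; [lra|]; apply Rinv_le_contravar; lra.
Qed.

Lemma term_head_lim : is_lim_seq (fun m => term m 0) (- (1 / 4) / sqrt 2).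
Proof.
pose proof (sqrt_lt_R0 2 ltac:(lra)) as Hs2.
apply is_lim_seq_ext with
  (fun m => (- (INR m ^ 2 - 19 / 256) / (4 * (INR m ^ 2 - 1 / 16))) / root2_approx m).
{ intros m; unfold term; rewrite weight_0, scale_eq; unfold term_poly; simpl (INR 0).
  pose proof (pos_INR m); pose proof (INR_neq_quarter m).
  assert (root2_approx m <> 0).
  { pose proof (scale_neq0 m) as H1; rewrite scale_eq in H1.
    intros H2; apply H1; rewrite H2; ring. }
  field; repeat split; try lra.
  replace (INR m ^ 2 * 16 - 1) with ((16 * INR m + 4) * (INR m - 1 / 4)) by field.
  apply Rmult_integral_contrapositive_currified; lra. }
apply is_lim_seq_div'; [| |lra].
- apply (is_lim_seq_harmonic_bound _ _ 1); intros m.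
  rewrite S_INR; pose proof (pos_INR m) as Hm; set (x := INR m + 1).
  assert (1 <= x) by (unfold x; lra).
  replace (_ - _) with ((3 / 1024) / (x ^ 2 - 1 / 16)) by (field; nra).
  assert (0 < x ^ 2 - 1 / 16) by nra.
  rewrite Rabs_pos_eq by (apply Rlt_le, Rdiv_lt_0_compat; lra).
  apply Rle_div_l; [lra|]; apply (Rmult_le_reg_l x); [lra|].
  replace (x * (1 / x * (x ^ 2 - 1 / 16))) with (x ^ 2 - 1 / 16) by (field; lra); nra.
- apply (is_lim_seq_harmonic_bound _ _ 1); intros m.
  unfold Rdiv; rewrite Rmult_1_l; apply root2_approx_bounds.
Qed.

Lemma Series_term_0 : Series (term 0) = - (1 / 4) / sqrt 2.
Proof.
assert (H : is_lim_seq (fun _ => Series (term 0)) (- (1 / 4) / sqrt 2)).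
{ apply is_lim_seq_ext with (fun m => term m 0 + Series (fun n => term m (S n))).
  - intros m; rewrite <- (Series_term_const m); symmetry.
    apply Series_incr_1, ex_series_term.
  - replace (Finite (- (1 / 4) / sqrt 2)) with (Finite (- (1 / 4) / sqrt 2 + 0))
      by (f_equal; ring).
    apply is_lim_seq_plus'; [apply term_head_lim|apply term_tail_lim]. }
apply is_lim_seq_unique in H; rewrite Lim_seq_const in H; now injection H.
Qed.

(** At m = 0 the cubic factors as (40n + 19)(n + 1/4)(n - 1/8) / 8.  The factor
    n + 1/4 cancels against the last factor of the (n+1)-term symbol, and n - 1/8
    turns (-1/8)_n into -1/8 times (7/8)_n. *)
Lemma summand_eq (n : nat) :
  (- (1 / 4)) ^ n
  * ((poch (5 / 8) n * poch (3 / 4) n * poch (9 / 8) n)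
     / (poch (1 / 2) n * poch 1 n * poch (3 / 2) n))
  * (40 * INR n + 19)
  = - 64 * term 0 n.
Proof.
unfold term, weight, term_poly, scale; simpl (INR 0); rewrite !Rplus_0_r.
pose proof (poch_shift_comm (- (1 / 8)) n) as H.
replace (- (1 / 8) + 1) with (7 / 8) in H by field.
cbn [rising_factorial].
pose proof (pos_INR n).
pose proof (poch_pos 1 n ltac:(lra)); pose proof (poch_pos (3 / 2) n ltac:(lra)).
pose proof (poch_pos (3 / 8) n ltac:(lra)); pose proof (poch_pos (7 / 8) n ltac:(lra)).
pose proof (poch_pos (1 / 2) n ltac:(lra)); pose proof (poch_pos (1 / 4) n ltac:(lra)).
assert (H8 : INR n - 1 / 8 <> 0).
{ destruct n as [|k]; [simpl; lra|rewrite S_INR; pose proof (pos_INR k); lra]. }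
replace (poch (- (1 / 8)) n) with (- (1 / 8) * poch (7 / 8) n / (INR n - 1 / 8))
  by (rewrite H; field; lra).
field; repeat split; lra.
Qed.

Theorem mainTheorem6 :
  is_series
    (fun j : nat =>
       (- (1 / 4)) ^ j
       * ((rising_factorial (5 / 8) j * rising_factorial (3 / 4) j
           * rising_factorial (9 / 8) j)
          / (rising_factorial (1 / 2) j * rising_factorial 1 j
             * rising_factorial (3 / 2) j))
       * (40 * INR j + 19))
    (8 * sqrt 2).
Proof.
apply is_series_ext with (fun n => - 64 * term 0 n).
{ intros n; symmetry; apply summand_eq. }
replace (8 * sqrt 2) with (- 64 * Series (term 0)).
- apply (is_series_scal_l (K := R_AbsRing) (- 64) (term 0) (Series (term 0))).
  apply Series_correct, ex_series_term.
- rewrite Series_term_0; pose proof (sqrt_lt_R0 2 ltac:(lra)).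
  apply (Rmult_eq_reg_r (sqrt 2)); [|lra].
  transitivity 16; [field; lra|].
  rewrite Rmult_assoc, sqrt_sqrt by lra; ring.
Qed.
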